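(* Every generic Lie checkerboard incircular net is the image under a Lie transformation of a hyperbolic, elliptic, or Euclidean checkerboard incircular net.
   Context: Let $\langle x,y\rangle = x_1y_1+x_2y_2+x_3y_3-x_4y_4-x_5y_5$ on $\mathbb{R}^5$ and let $\mathcal{L}=\{[x]\in\mathbb{R}\mathrm{P}^4 : \langle x,x\rangle=0\}$ be the Lie quadric, whose points are identified with oriented circles on $\mathbb{S}^2$ via $(c,r)\mapsto[c,\cos r,\sin r]$ ($c\in\mathbb{S}^2$ the center, $r$ the signed spherical radius). Lie transformations are the elements of $\mathrm{PO}(3,2)$, the projectivization of the group of linear maps of $\mathbb{R}^5$ preserving $\langle\cdot,\cdot\rangle$. Four oriented circles are called circumscribed if the corresponding points on $\mathcal{L}$ are coplanar. A Lie checkerboard incircular net consists of two families $(\ell_i)_{i\in\mathbb{Z}}$, $(m_j)_{j\in\mathbb{Z}}$ of oriented circles (points of $\mathcal{L}$) such that $(\ell_i,\ell_{i+1},m_j,m_{j+1})$ is circumscribed for all $i,j$ with $i+j$ even. It is generic if for all $i,j$ with $i+j$ even the eight points $\ell_i,\dots,\ell_{i+3},m_j,\dots,m_{j+3}$ are pairwise distinct and no five of them are coplanar. Let $\varepsilon=-1,1,0$ in the hyperbolic, elliptic, Euclidean case. The Laguerre quadric is $\mathcal{B}=\{[z]\in\mathbb{R}\mathrm{P}^3: z_1^2+z_2^2+\varepsilon z_3^2-z_4^2=0\}$. Oriented lines of the respective plane are identified with points of $\mathcal{B}$ (for $\varepsilon=0$ excluding the vertex $[0,0,1,0]$), and oriented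 (Laguerre) circles with planar sections of $\mathcal{B}$, so that four oriented lines touch a common oriented circle iff the corresponding points are coplanar. A hyperbolic/elliptic/Euclidean checkerboard incircular net consists of two families $(\ell_i)_{i\in\mathbb{Z}}$, $(m_j)_{j\in\mathbb{Z}}$ of oriented lines such that for all $i,j$ with $i+j$ even the four lines $\ell_i,\ell_{i+1},m_j,m_{j+1}$ touch a common oriented circle. Each Laguerre geometry is a subgeometry of Lie geometry by identifying $\mathcal{B}$ with the section $\mathcal{L}\cap \mathbf{q}^\perp$, $\mathbf q^\perp=\{[x]:\langle x,q\rangle=0\}$, where: in the hyperbolic case $\mathbf{q}=[0,0,1,0,0]$ and $[z_1,z_2,z_3,z_4]\leftrightarrow[z_1,z_2,0,z_3,z_4]$; in the elliptic case $\mathbf{q}=[0,0,0,1,0]$ and $[z]\leftrightarrow[z_1,z_2,z_3,0,z_4]$; in the Euclidean case $\mathbf{q}=[0,0,1,1,0]$ and $[z]\leftrightarrow[z_1,z_2,z_3,z_3,z_4]$. In this way a hyperbolic/elliptic/Euclidean checkerboard incircular net is regarded as a Lie checkerboard incircular net. *)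

(* Defs.v *)
From HB Require Import structures.
From mathcomp Require Import all_boot all_order all_algebra.
From mathcomp Require Import reals.

Set Implicit Arguments.
Unset Strict Implicit.
Unset Printing Implicit Defensive.

Import Order.TTheory GRing.Theory Num.Theory.
Local Open Scope ring_scope.

(* The projective space P(V): its points are the lines of V through 0, so that
   equality of points is equality of homogeneous coordinates up to a scalar. *)
Record projpoint (K : fieldType) (V : vectType K) := ProjPoint {
  line_of :> {vspace V};
  dim_line_of : \dim line_of == 1%N
}.

HB.instance Definition _ (K : fieldType) (V : vectType K) :=
  [isSub for @line_of K V].
HB.instance Definition _ (K : fieldType) (V : vectType K) :=
  [Choice of projpoint V by <:].

(* Projective planes of P(V) are the 3-dimensional subspaces of V. *)
Definition coplanar (K : fieldType) (V : vectType K) (s : seq (projpoint V)) :=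
  exists2 E : {vspace V}, \dim E = 3%N & forall p, p \in s -> (p <= E)%VS.

Fact dim_proj_map (K : fieldType) (V W : vectType K) (f : 'Hom(V, W))
  (f_inj : lker f == 0%VS) (p : projpoint V) : \dim (f @: p)%VS == 1%N.
Proof. by rewrite limg_dim_eq ?(eqP f_inj) ?capv0 // dim_line_of. Qed.

Definition proj_map (K : fieldType) (V W : vectType K) (f : 'Hom(V, W))
    (f_inj : lker f == 0%VS) (p : projpoint V) : projpoint W :=
  ProjPoint (dim_proj_map f_inj p).

Definition diag_form (K : fieldType) (n : nat) (s : seq K) (x y : 'rV[K]_n) : K :=
  \sum_(i < n) s`_i * x 0 i * y 0 i.

Definition on_quadric (K : fieldType) (n : nat) (b : 'rV[K]_n -> 'rV[K]_n -> K)
    (p : projpoint 'rV[K]_n) :=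
  forall x, x \in line_of p -> b x x = 0.

Definition lie_form (R : realType) : 'rV[R]_5 -> 'rV[R]_5 -> R :=
  diag_form [:: 1; 1; 1; -1; -1].

Definition lie_transformation (R : realType)
    (T : projpoint 'rV[R]_5 -> projpoint 'rV[R]_5) :=
  exists (f : 'End('rV[R]_5)) (f_inj : lker f == 0%VS),
    (forall x y, lie_form (f x) (f y) = lie_form x y) /\ T =1 proj_map f_inj.

Definition lie_checkerboard_net (R : realType)
    (l m : int -> projpoint 'rV[R]_5) :=
  [/\ forall i, on_quadric (@lie_form R) (l i),
      forall j, on_quadric (@lie_form R) (m j) &
      forall i j : int, (2 %| i + j)%Z ->
        coplanar [:: l i; l (i + 1); m j; m (j + 1)]].

Definition generic_net (R : realType) (l m : int -> projpoint 'rV[R]_5) :=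
  forall i j : int, (2 %| i + j)%Z ->
    let octet := [:: l i; l (i + 1); l (i + 2); l (i + 3);
                     m j; m (j + 1); m (j + 2); m (j + 3)] in
    uniq octet /\
    forall s, size s = 5%N -> uniq s -> {subset s <= octet} -> ~ coplanar s.

Variant plane_geometry := Hyperbolic | Elliptic | Euclidean.

Definition epsilon (R : realType) (g : plane_geometry) : R :=
  match g with Hyperbolic => -1 | Elliptic => 1 | Euclidean => 0 end.

Definition laguerre_form (R : realType) (g : plane_geometry) :
    'rV[R]_4 -> 'rV[R]_4 -> R :=
  diag_form [:: 1; 1; epsilon R g; -1].

Definition euclidean_vertex (R : realType) : 'rV[R]_4 := delta_mx 0 2.

Definition oriented_line (R : realType) (g : plane_geometry)
    (p : projpoint 'rV[R]_4) :=
  on_quadric (laguerre_form g) p /\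
  (g = Euclidean -> line_of p <> <[euclidean_vertex R]>%VS).

(* Oriented circles are the planar sections of the Laguerre quadric, so lines
   touching a common oriented circle are lines lying in a common plane. *)
Definition laguerre_checkerboard_net (R : realType) (g : plane_geometry)
    (l m : int -> projpoint 'rV[R]_4) :=
  [/\ forall i, oriented_line g (l i),
      forall j, oriented_line g (m j) &
      forall i j : int, (2 %| i + j)%Z ->
        coplanar [:: l i; l (i + 1); m j; m (j + 1)]].

Definition lie_coords (R : realType) (g : plane_geometry) (z : 'rV[R]_4) :
    'rV[R]_5 :=
  \row_(k < 5) (match g with
    | Hyperbolic => [:: z 0 0; z 0 1; 0; z 0 2; z 0 3]
    | Elliptic   => [:: z 0 0; z 0 1; z 0 2; 0; z 0 3]
    | Euclidean  => [:: z 0 0; z 0 1; z 0 2; z 0 2; z 0 3]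
    end)`_k.

Fact lie_coords_is_linear (R : realType) (g : plane_geometry) :
  linear (@lie_coords R g).
Proof.
move=> a u v; apply/rowP => k; rewrite !mxE.
by case: g; case: k => [[|[|[|[|[|k]]]]] //= _];
  rewrite ?mxE ?mulr0 ?addr0.
Qed.

HB.instance Definition _ (R : realType) (g : plane_geometry) :=
  GRing.isLinear.Build R 'rV[R]_4 'rV[R]_5 _ (@lie_coords R g)
    (lie_coords_is_linear g).

(* A representative of q; [lie_coords_pole] shows that [lie_coords] maps onto
   q^perp. *)
Definition laguerre_pole (R : realType) (g : plane_geometry) : 'rV[R]_5 :=
  match g with
  | Hyperbolic => delta_mx 0 2
  | Elliptic   => delta_mx 0 3
  | Euclidean  => delta_mx 0 2 + delta_mx 0 3
  end.

Lemma lie_form_lie_coords (R : realType) (g : plane_geometry)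
  (z w : 'rV[R]_4) :
  lie_form (lie_coords g z) (lie_coords g w) = laguerre_form g z w.
Proof.
rewrite /lie_form /laguerre_form /diag_form !big_ord_recl !big_ord0 !mxE /=.
have e1 : lift ord0 ord0 = 1 :> 'I_4 by apply: val_inj.
have e2 : lift ord0 (lift ord0 ord0) = 2 :> 'I_4 by apply: val_inj.
have e3 : lift ord0 (lift ord0 (lift ord0 ord0)) = 3 :> 'I_4 by apply: val_inj.
rewrite e1 e2 e3; case: g => /=; rewrite ?mulr0 ?mul0r ?add0r ?addr0 //.
by congr (_ + (_ + _)); rewrite !mulN1r !mul1r mulNr addrA subrr add0r.
Qed.

Lemma lie_coords_pole (R : realType) (g : plane_geometry) (x : 'rV[R]_5) :
  (exists z, x = lie_coords g z) <-> lie_form x (laguerre_pole R g) = 0.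
Proof.
have form_pole : lie_form x (laguerre_pole R g) =
    match g with
    | Hyperbolic => x 0 2
    | Elliptic => - x 0 3
    | Euclidean => x 0 2 - x 0 3
    end.
  rewrite /lie_form /diag_form (bigD1 2) //= (bigD1 3) //= big1 => [|k].
    by case: g; rewrite /= !mxE /= ?(mulr0, mulr1, addr0, add0r, mul1r, mulN1r).
  case: k => [[|[|[|[|[|k]]]]] //= ki] _;
    by case: g; rewrite /= !mxE /= ?addr0 mulr0.
rewrite form_pole; split=> [[z ->]|x0].
  by case: g {form_pole}; rewrite !mxE /= ?oppr0 ?subrr.
exists (\row_(k < 4) (match g with
    | Hyperbolic => [:: x 0 0; x 0 1; x 0 3; x 0 4]
    | _ => [:: x 0 0; x 0 1; x 0 2; x 0 4] end)`_k).
apply/rowP => k; rewrite !mxE.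
have xE (i j : 'I_5) : val i = val j -> x 0 i = x 0 j.
  by move=> /val_inj ->.
case: k => [[|[|[|[|[|k]]]]] //= ki];
  [ by case: g {x0 form_pole}; apply: xE | by case: g {x0 form_pole}; apply: xE
  | rewrite (xE _ 2) // | rewrite (xE _ 3) // | rewrite (xE _ 4) //].
- by case: g x0 {form_pole}.
- case: g x0 {form_pole} => //= /eqP; first by rewrite oppr_eq0 => /eqP.
  by rewrite subr_eq0 => /eqP.
- by case: g {x0 form_pole}.
Qed.

Fact lker_lie_coords (R : realType) (g : plane_geometry) :
  lker (linfun (@lie_coords R g)) == 0%VS.
Proof.
apply/lker0P => u v; rewrite !lfunE /= => /rowP E.
have lE (w : 'rV[R]_4) (i j : 'I_4) : val i = val j -> w 0 i = w 0 j.
  by move=> /val_inj ->.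
apply/rowP; case=> [[|[|[|[|k]]]] //= ki].
- by move: (E 0); rewrite !mxE !(lE _ (Ordinal ki) 0) //; case: g {E}.
- by move: (E 1); rewrite !mxE !(lE _ (Ordinal ki) 1) //; case: g {E}.
- by move: (E 2) (E 3); rewrite !mxE !(lE _ (Ordinal ki) 2) //; case: g {E}.
- by move: (E 4); rewrite !mxE !(lE _ (Ordinal ki) 3) //; case: g {E}.
Qed.

Definition laguerre_embedding (R : realType) (g : plane_geometry) :
    projpoint 'rV[R]_4 -> projpoint 'rV[R]_5 :=
  proj_map (lker_lie_coords R g).

(* Main.v *)
(* All the circles lie in one hyperplane q^perp.  In an octet, the lines
   (l0 l1), (l2 l3) both meet (m0 m1), (m2 m3); by genericity this confines the
   eight points to a 3-space, and consecutive octets share six points, hence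
   span the same 3-space.  According to the sign of <q,q>, a product of
   reflections carries the pole of one of the three Laguerre geometries to a
   multiple of q.  In the Euclidean case no circle of the net is the vertex q of
   the cone: each of the planes through it would contain two points on a common
   generator, and two such coincidences produce five coplanar points. *)

Require Import Defs.
From HB Require Import structures.
From mathcomp Require Import all_boot all_order all_algebra.
From mathcomp Require Import reals ring lra zify.

Set Implicit Arguments.
Unset Strict Implicit.
Unset Printing Implicit Defensive.

Import Order.TTheory GRing.Theory Num.Theory.
Local Open Scope ring_scope.

(** * Membership and reordering in short lists *)

Lemma seq3_mem (T : eqType) (a b c : T) :
  [/\ a \in [:: a; b; c], b \in [:: a; b; c] & c \in [:: a; b; c]].
Proof. by rewrite !inE !eqxx !orbT. Qed.

Lemma seq4_mem (T : eqType) (a b c d : T) :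
  [/\ a \in [:: a; b; c; d], b \in [:: a; b; c; d], c \in [:: a; b; c; d]
    & d \in [:: a; b; c; d]].
Proof. by rewrite !inE !eqxx !orbT. Qed.

(** The reorderings that exchange the two families, or that arrange a circumscribed quadruple in the
    order of [octet_not_two_collinear]. *)
Lemma seq4_sub (T : eqType) (a b c d : T) :
  [/\ {subset [:: a; b; c; d] <= [:: c; d; a; b]},
      {subset [:: b; a; c; d] <= [:: a; b; c; d]} &
      {subset [:: a; b; d; c] <= [:: a; b; c; d]}].
Proof.
by split=> x; rewrite !inE; do 4 case: (x == _).
Qed.

(** * Spans of points and the dimension of an octet *)

Section ProjectiveSpan.
Variables (K : fieldType) (V : vectType K).
Implicit Types (p q r s v w d : projpoint V) (U W : {vspace V}).

Lemma projpoint_vec p : exists2 x, x != 0 & line_of p = <[x]>%VS.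
Proof.
have x0 : vpick p != 0.
  by rewrite vpick0 -dimv_eq0 (eqP (dim_line_of p)).
exists (vpick p) => //; apply/eqP; rewrite eq_sym eqEdim dim_vline x0.
by rewrite (eqP (dim_line_of p)) andbT -memvE memv_pick.
Qed.

Lemma projpoint_capv p U : ~~ (p <= U)%VS -> (p :&: U)%VS = 0%VS.
Proof.
move=> pU; apply/eqP; rewrite -dimv_eq0 -leqn0 leqNgt; apply/negP => d0.
case/negP: pU; apply/capv_idPl/eqP.
by rewrite eqEdim capvSl (eqP (dim_line_of p)).
Qed.

Lemma projpoint_sub p q : (p <= q)%VS -> p = q.
Proof.
move=> pq; apply/val_inj/eqP.
by rewrite eqEdim pq (eqP (dim_line_of p)) (eqP (dim_line_of q)).
Qed.

Lemma dim_addv_projpoint p U : (\dim (p + U) <= (\dim U).+1)%N.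
Proof.
by have := dimv_sum_cap p U; rewrite (eqP (dim_line_of p)); lia.
Qed.

Lemma dim_join p q : p != q -> \dim (p + q) = 2%N.
Proof.
move=> pq; rewrite dimv_disjoint_sum ?(eqP (dim_line_of _)) //.
by apply: projpoint_capv; apply: contra pq => /projpoint_sub ->.
Qed.

Lemma join_sub p q r U : p != q -> (p <= U)%VS -> (q <= U)%VS ->
  \dim U = 2%N -> (r <= U)%VS -> (r <= p + q)%VS.
Proof.
move=> pq pU qU dU rU.
suff -> : (p + q)%VS = U by exact: rU.
by apply/eqP; rewrite eqEdim subv_add pU qU dim_join ?dU.
Qed.

Lemma vspace_extend U (n : nat) : (\dim U <= n <= dim V)%N ->
  exists2 E : {vspace V}, \dim E = n & (U <= E)%VS.
Proof.
elim: n => [|n IH].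
  by rewrite leqn0 => /andP[/eqP dU _]; exists U.
rewrite leq_eqVlt => /andP[/orP[/eqP dU _|dU nV]]; first by exists U.
have [|E dE UE] := IH; first by rewrite -ltnS dU ltnW.
have /subvPn[x _ xE] : ~~ (fullv <= E)%VS.
  by apply: contraTN nV => /dimvS; rewrite dimvf dE -leqNgt.
exists (E + <[x]>)%VS; last by rewrite (subv_trans UE) ?addvSl.
rewrite dimv_disjoint_sum ?dE ?dim_vline; last first.
  apply/eqP; rewrite -subv0; apply/subvP => y; rewrite memv_cap => /andP[yE].
  case/vlineP => k ky; move: yE; rewrite ky.
  have [-> _|k0] := eqVneq k 0; first by rewrite scale0r mem0v.
  by move=> /(memvZ k^-1); rewrite scalerA mulVf // scale1r (negPf xE).
by case: eqVneq xE => [->|_]; rewrite ?mem0v ?addn1.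
Qed.

(** [coplanar] asks for a subspace of dimension exactly 3, so a smaller span has to be enlarged
    inside [V]. *)
Lemma coplanar_span (s : seq (projpoint V)) U : (3 <= dim V)%N ->
  (\dim U <= 3)%N -> {in s, forall p, (line_of p <= U)%VS} -> coplanar s.
Proof.
move=> V3 U3 sU; have [|E dE UE] := @vspace_extend U 3; first by rewrite U3.
by exists E => // p /sU /subv_trans; apply.
Qed.

Lemma coplanar_join p q r s : coplanar [:: p; q; r; s] ->
  (\dim (p + q + (r + s)) <= 3)%N.
Proof.
case=> E dE sE; rewrite -dE; apply: dimvS.
have [pE qE rE tE] := seq4_mem p q r s.
by rewrite !subv_add (sE _ pE) (sE _ qE) (sE _ rE) (sE _ tE).
Qed.

Lemma coplanar_sub (s t : seq (projpoint V)) :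
  {subset t <= s} -> coplanar s -> coplanar t.
Proof. by move=> ts [E dE sE]; exists E => // p /ts /sE. Qed.

(** The condition that [generic_net] puts on one pair of indices, stated for an arbitrary projective
    space. *)
Definition general_octet (o : seq (projpoint V)) :=
  uniq o /\
  forall s : seq (projpoint V), size s = 5%N -> uniq s -> {subset s <= o} ->
  ~ coplanar s.

Lemma general_octet_catC (s t : seq (projpoint V)) :
  general_octet (s ++ t) -> general_octet (t ++ s).
Proof.
case=> u g; split=> [|r r5 ur rs]; first by rewrite uniq_catC.
by apply: g => // p /rs; rewrite !mem_cat orbC.
Qed.

(** Genericity as a lower bound on dimensions. Selecting the five points by a mask makes their
    distinctness and membership automatic. *)
Lemma general_octet_mask o (b : bitseq) U : (3 <= dim V)%N ->
  general_octet o -> size (mask b o) = 5%N ->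
  all (fun p => line_of p <= U)%VS (mask b o) -> (3 < \dim U)%N.
Proof.
move=> V3 [uo go] s5 /allP sU; rewrite ltnNge; apply/negP => U3.
apply: (go _ s5 (mask_uniq uo b)); first by move=> p /mem_mask.
exact: coplanar_span U3 sU.
Qed.

(** The traces of [W] on the two skew subspaces are independent, so together they already fill the
    dimension 2 of [W]. *)
Lemma transversal_sub U1 U2 W : (U1 :&: U2)%VS = 0%VS -> \dim W = 2%N ->
  (U1 :&: W)%VS != 0%VS -> (U2 :&: W)%VS != 0%VS -> (W <= U1 + U2)%VS.
Proof.
move=> U12 dW; rewrite -!dimv_eq0 -!lt0n => W1 W2.
have := dimv_sum_cap (U1 :&: W) (U2 :&: W).
have -> : ((U1 :&: W) :&: (U2 :&: W))%VS = 0%VS.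
  apply/eqP; rewrite -subv0 -U12.
  by apply: capvS; exact: capvSl.
rewrite dimv0 => d.
have /eqP <- : (U1 :&: W + (U2 :&: W))%VS == W.
  by rewrite eqEdim subv_add !capvSr dW; lia.
by apply: addvS; exact: capvSl.
Qed.

(** As [P] differs from [p1] and [p2], the outer lines are [P p1] and [P p2]; both coincide with the
    middle line, which contains [P]. *)
Lemma collinear_chain (P p0 p1 p2 p3 : projpoint V) :
  uniq [:: p0; p1; p2; p3] -> P != p1 -> P != p2 ->
  (P <= p0 + p1)%VS -> (P <= p1 + p2)%VS -> (P <= p2 + p3)%VS ->
  (p0 + p1 + (p2 + p3) <= p1 + p2)%VS.
Proof.
rewrite /= !inE !negb_or => /andP[/and3P[p01 p02 p03] /andP[/andP[p12 p13]]].
rewrite andbT => p23 P1 P2 P01 P12 P23.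
have sub p q r : P != q -> p != q -> q != r -> (P <= p + q)%VS ->
    (P <= q + r)%VS -> (p <= q + r)%VS.
  move=> Pq pq qr Ppq Pqr; apply: (@subv_trans _ _ (P + q)%VS).
    by apply: (@join_sub _ _ _ (p + q)%VS);
      rewrite ?addvSl ?addvSr ?dim_join.
  by rewrite subv_add Pqr addvSl.
rewrite !subv_add addvSl addvSr (sub p0 p1 p2) //=.
rewrite eq_sym in p12; rewrite eq_sym in p23.
by rewrite addvC (sub p3 p2 p1 P2 p23 p12) // addvC.
Qed.

Lemma dim_addv_meet U W : \dim U = 2%N -> \dim W = 2%N ->
  (U :&: W)%VS != 0%VS -> (\dim (U + W) <= 3)%N.
Proof.
move=> dU dW; rewrite -dimv_eq0 -lt0n.
by have := dimv_sum_cap U W; rewrite dU dW; lia.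
Qed.

Lemma meet_of_coplanar p q r s : p != q -> r != s ->
  (\dim (p + q + (r + s)) <= 3)%N -> ((p + q) :&: (r + s))%VS != 0%VS.
Proof.
move=> pq rs; rewrite -dimv_eq0 -lt0n.
by have := dimv_sum_cap (p + q) (r + s); rewrite !dim_join //; lia.
Qed.

(* If the lines [l0 l1], [l2 l3] are skew, their span contains their transversals
   [m0 m1], [m2 m3], and vice versa. Otherwise the [l]'s lie in a plane, and so
   do the [m]'s; if these planes shared only a point [P], then every line of the
   octet would pass through [P], making the [l]'s or the [m]'s collinear. *)
Lemma octet_dim (l0 l1 l2 l3 m0 m1 m2 m3 : projpoint V) :
  (3 <= dim V)%N -> general_octet [:: l0; l1; l2; l3; m0; m1; m2; m3] ->
  coplanar [:: l0; l1; m0; m1] -> coplanar [:: l0; l1; m2; m3] ->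
  coplanar [:: l2; l3; m0; m1] -> coplanar [:: l2; l3; m2; m3] ->
  coplanar [:: l1; l2; m1; m2] ->
  \dim (l0 + l1 + (l2 + l3) + (m0 + m1 + (m2 + m3))) = 4%N.
Proof.
move=> V3 go pl00 pl02 pl20 pl22 pl11.
have [+ _] := go; rewrite [uniq _]/= !inE !negb_or -!andbA.
case/and5P=> l01 l02 l03 _ /and5P[_ _ _ l12 /and5P[l13 l1m0 l1m1 l1m2]].
case/and5P=> l1m3 l23 l2m0 l2m1 /and5P[l2m2 l2m3 _ _ /and5P[_ _ m01 m02]].
case/and5P=> m03 m12 m13 m23 _.
set A := (l0 + l1 + (l2 + l3))%VS; set B := (m0 + m1 + (m2 + m3))%VS.
have := subvv A; rewrite {1}/A !subv_add.
case/andP=> /andP[l0A l1A] /andP[l2A l3A].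
have := subvv B; rewrite {1}/B !subv_add.
case/andP=> /andP[m0B m1B] /andP[m2B m3B].
have [AS BS] := (addvSl A B, addvSr A B).
apply/eqP; rewrite eqn_leq; apply/andP; split; last first.
  apply: (general_octet_mask (b := nseq 5 true) V3 go) => //=.
  rewrite (subv_trans l0A AS) (subv_trans l1A AS) (subv_trans l2A AS).
  by rewrite (subv_trans l3A AS) (subv_trans m0B BS).
have [A0 | A0] := eqVneq ((l0 + l1) :&: (l2 + l3))%VS 0%VS.
  have -> : (A + B = A)%VS.
    apply/addv_idPl; rewrite subv_add.
    by rewrite !transversal_sub ?dim_join ?meet_of_coplanar ?coplanar_join.
  by rewrite dimv_disjoint_sum ?dim_join.
have [B0 | B0] := eqVneq ((m0 + m1) :&: (m2 + m3))%VS 0%VS.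
  have -> : (A + B = B)%VS.
    apply/addv_idPr; rewrite subv_add.
    by rewrite !transversal_sub ?dim_join // capvC ?meet_of_coplanar
      ?coplanar_join.
  by rewrite dimv_disjoint_sum ?dim_join.
have dA : (\dim A <= 3)%N.
  by apply: dim_addv_meet A0; rewrite dim_join.
have dB : (\dim B <= 3)%N.
  by apply: dim_addv_meet B0; rewrite dim_join.
have dAB := dimv_sum_cap A B.
rewrite leqNgt; apply/negP => d5.
(* Two spaces of dimension at most 3 with a sum of dimension at least 5. *)
have {dAB d5} dAB : (\dim (A :&: B) <= 1)%N.
  clear -dA dB dAB d5; lia.
(* [A :&: B] is at most a point, so any nonzero meet of parts of [A] and [B] is all of it. *)
have meetE (U W : {vspace V}) : (U <= A)%VS -> (W <= B)%VS ->
    (U :&: W)%VS != 0%VS -> (U :&: W = A :&: B)%VS.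
  move=> UA WB; rewrite -dimv_eq0 -lt0n => UW.
  by apply/eqP; rewrite eqEdim capvS //= (leq_trans dAB).
have E00 := meetE _ _ (addvSl _ _) (addvSl _ _)
  (meet_of_coplanar l01 m01 (coplanar_join pl00)).
have E22 := meetE _ _ (addvSr _ _) (addvSr _ _)
  (meet_of_coplanar l23 m23 (coplanar_join pl22)).
have E11 : ((l1 + l2) :&: (m1 + m2) = A :&: B)%VS.
  apply: meetE; rewrite ?subv_add ?l1A ?l2A ?m1B ?m2B //.
  exact: meet_of_coplanar l12 m12 (coplanar_join pl11).
have dP : \dim (A :&: B) == 1%N.
  rewrite eqn_leq dAB lt0n dimv_eq0 -E00.
  by rewrite meet_of_coplanar ?coplanar_join.
pose P := ProjPoint dP.
have PE : line_of P = (A :&: B)%VS by [].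
have PU U W : (U :&: W = A :&: B)%VS -> (P <= U)%VS /\ (P <= W)%VS.
  by rewrite PE => <-; rewrite capvSl capvSr.
have [[PL0 PM0] [PL1 PM1]] := (PU _ _ E00, PU _ _ E11).
have [PL2 PM2] := PU _ _ E22.
(* If [P] avoids [l1] and [l2], the [l]'s are collinear. Otherwise [P] is one of them, hence differs
   from [m1] and [m2], and the [m]'s are collinear. A line with four points and one further point
   give five coplanar points. *)
have [[Pl1 Pl2]|Pl] : (P != l1 /\ P != l2) \/ (P = l1 \/ P = l2).
  by case: (eqVneq P l1); case: (eqVneq P l2); auto.
  have lA : (A <= l1 + l2)%VS.
    apply: (@collinear_chain P) => //.
    by have [/(subseq_uniq (take_subseq _ 4))] := go.
  have: (3 < \dim (m0 + A))%N.
    apply: (general_octet_mask (b := nseq 5 true) V3 go) => //=.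
    have mA p : (p <= A)%VS -> (p <= m0 + A)%VS.
      by move=> pA; rewrite (subv_trans pA) ?addvSr.
    by rewrite addvSl !mA.
  apply/negP; rewrite -leqNgt (leq_trans (dim_addv_projpoint _ _)) // ltnS.
  by rewrite -(dim_join l12) dimvS.
have Pm (m : projpoint V) : l1 != m -> l2 != m -> P != m by case: Pl => ->.
have mB : (B <= m1 + m2)%VS.
  apply: (@collinear_chain P) => //.
  - by have [/(subseq_uniq (drop_subseq _ 4))] := go.
  - exact: Pm l1m1 l2m1.
  - exact: Pm l1m2 l2m2.
have: (3 < \dim (l0 + B))%N.
  apply: (general_octet_mask (b := true :: nseq 3 false ++ nseq 4 true) V3 go)
    => //=.
  have lB p : (p <= B)%VS -> (p <= l0 + B)%VS.
    by move=> pB; rewrite (subv_trans pB) ?addvSr.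
  by rewrite addvSl !lB.
apply/negP; rewrite -leqNgt (leq_trans (dim_addv_projpoint _ _)) // ltnS.
by rewrite -(dim_join m12) dimvS.
Qed.

(** * Collinear triples in an octet *)

(** The bound [<= 2] lets an isotropic subspace serve as witness without computing its exact
    dimension. *)
Definition collinear v p q := exists2 U : {vspace V}, (\dim U <= 2)%N &
  [/\ (v <= U)%VS, (p <= U)%VS & (q <= U)%VS].

Definition in_plane p q r s (t : projpoint V) :=
  exists2 U : {vspace V}, (\dim U <= 3)%N &
  [/\ (p <= U)%VS, (q <= U)%VS, (r <= U)%VS, (s <= U)%VS & (t <= U)%VS].

(** Both lines pass through [v], so their sum loses at least one dimension. *)
Lemma in_plane_lines v p q r s : collinear v p q -> collinear v r s ->
  in_plane v p q r s.
Proof.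
case=> U dU [vU pU qU] [W dW [vW rW sW]]; exists (U + W)%VS.
  have := dimv_sum_cap U W.
  have /dimvS : (v <= U :&: W)%VS by rewrite subv_cap vU.
  by rewrite (eqP (dim_line_of v)); lia.
have [UL WR] := (addvSl U W, addvSr U W).
by split; first [exact: subv_trans UL | exact: subv_trans WR].
Qed.

(** The two lines share the distinct points [v] and [d], hence coincide; a line and any point [w]
    span at most a plane. *)
Lemma in_plane_line_point v d p q w : v != d -> collinear v p d ->
  collinear v q d -> in_plane w v d p q.
Proof.
move=> vd [U dU [vU pU dU']] [W dW [vW qW dW']].
have UE X : (v <= X)%VS -> (d <= X)%VS -> (\dim X <= 2)%N ->
    (v + d)%VS = X.
  by move=> vX dX X2; apply/eqP; rewrite eqEdim subv_add vX dX dim_join.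
exists (w + U)%VS; first by rewrite (leq_trans (dim_addv_projpoint _ _)).
have qU : (q <= U)%VS by rewrite -(UE U) // (UE W).
by split; rewrite ?addvSl ?(subv_trans _ (addvSr w U)).
Qed.

(** The quadruples [a v c d] and [v b d e] share only [v] and [d]. If [d] is on at most one of the
    two named triples, these consist of five points in the plane of two lines through [v]. If [d] is
    in both, they give four points on one line, and [w] is the fifth. *)
Lemma octet_not_two_collinear (a v b w c d e g : projpoint V) :
  (3 <= dim V)%N -> general_octet [:: a; v; b; w; c; d; e; g] ->
  [\/ collinear v a c, collinear v a d | collinear v c d] ->
  ~ [\/ collinear v b e, collinear v b d | collinear v e d].
Proof.
set o := [:: a; v; b; w; c; d; e; g] => V3 go.
have vd : v != d.
  have [+ _] := go; rewrite /= !inE !negb_or -!andbA.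
  by case/and5P=> _ _ _ _ /and5P[_ _ _ _ /and5P[]].
have five (u : bitseq) p q r s (t : projpoint V) : in_plane p q r s t ->
    size (mask u o) = 5%N ->
    (forall U, (p <= U)%VS -> (q <= U)%VS -> (r <= U)%VS -> (s <= U)%VS ->
      (t <= U)%VS -> all (fun x => line_of x <= U)%VS (mask u o)) -> False.
  case=> U dU [pU qU rU sU tU] u5 oU.
  have := general_octet_mask V3 go u5 (oU U pU qU rU sU tU).
  by rewrite ltnNge dU.
pose T := true; pose F := false.
case=> [ac|ad|cd] [be|bd|ed].
- by apply: (five [:: T; T; T; F; T; F; T])
    (in_plane_lines ac be) _ _ => //= U -> -> -> -> ->.
- by apply: (five [:: T; T; T; F; T; T])
    (in_plane_lines ac bd) _ _ => //= U -> -> -> -> ->.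
- by apply: (five [:: T; T; F; F; T; T; T])
    (in_plane_lines ac ed) _ _ => //= U -> -> -> -> ->.
- by apply: (five [:: T; T; T; F; F; T; T])
    (in_plane_lines ad be) _ _ => //= U -> -> -> -> ->.
- by apply: (five [:: T; T; T; T; F; T])
    (in_plane_line_point w vd ad bd) _ _ => //= U -> -> -> -> ->.
- by apply: (five [:: T; T; F; T; F; T; T])
    (in_plane_line_point w vd ad ed) _ _ => //= U -> -> -> -> ->.
- by apply: (five [:: F; T; T; F; T; T; T])
    (in_plane_lines cd be) _ _ => //= U -> -> -> -> ->.
- by apply: (five [:: F; T; T; T; T; T])
    (in_plane_line_point w vd cd bd) _ _ => //= U -> -> -> -> ->.
- by apply: (five [:: F; T; F; T; T; T; T])
    (in_plane_line_point w vd cd ed) _ _ => //= U -> -> -> -> ->.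
Qed.

End ProjectiveSpan.

(** * Pulling points back along an injective linear map *)

Section ProjectivePreimage.
Variables (K : fieldType) (V W : vectType K) (f : 'Hom(V, W)).
Hypothesis f_inj : lker f == 0%VS.

Fact dim_proj_preim (p : projpoint W) (pf : (p <= limg f)%VS) :
  \dim (f @^-1: p)%VS == 1%N.
Proof.
by rewrite -(limg_dim_eq (f := f)) ?(eqP f_inj) ?capv0 // lpreimK ?dim_line_of.
Qed.

Definition proj_preim (p : projpoint W) (pf : (p <= limg f)%VS) :=
  ProjPoint (dim_proj_preim pf).

Lemma proj_preimK (p : projpoint W) (pf : (p <= limg f)%VS) :
  proj_map f_inj (proj_preim pf) = p.
Proof. by apply: val_inj; rewrite /= lpreimK. Qed.

(** The preimage of a plane under an injective map has dimension at most 3. *)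
Lemma coplanar_preim (s : seq (projpoint V)) : (3 <= dim V)%N ->
  coplanar [seq proj_map f_inj p | p <- s] -> coplanar s.
Proof.
move=> V3 [E dE sE]; apply: (@coplanar_span _ _ _ (f @^-1: E)%VS V3).
  rewrite -(limg_dim_eq (f := f)) ?(eqP f_inj) ?capv0 // -dE dimvS //.
  by apply/subvP => _ /memv_imgP[x + ->]; rewrite -memv_preim.
move=> p ps; apply/subvP => x xp; rewrite -memv_preim.
by have /subvP := sE _ (map_f _ ps); apply; apply: memv_img.
Qed.

End ProjectivePreimage.

(** * The Lie form and its isometries *)

Section LieForm.
Variable R : realType.
Implicit Types (x y z n p q : 'rV[R]_5).

Lemma lie_formE x y : lie_form x y =
  x 0 0 * y 0 0 + x 0 1 * y 0 1 + x 0 2 * y 0 2 - x 0 3 * y 0 3 - x 0 4 * y 0 4.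
Proof.
rewrite /lie_form /diag_form !big_ord_recl big_ord0 /=.
have -> : lift ord0 ord0 = 1 :> 'I_5 by apply: val_inj.
have -> : lift ord0 (lift ord0 ord0) = 2 :> 'I_5 by apply: val_inj.
have -> : lift ord0 (lift ord0 (lift ord0 ord0)) = 3 :> 'I_5 by apply: val_inj.
have -> : lift ord0 (lift ord0 (lift ord0 (lift ord0 ord0))) = 4 :> 'I_5.
  by apply: val_inj.
ring.
Qed.

Lemma lie_formC x y : lie_form x y = lie_form y x.
Proof. by rewrite !lie_formE; ring. Qed.

Lemma lie_formDl x y z : lie_form (x + y) z = lie_form x z + lie_form y z.
Proof. by rewrite !lie_formE !mxE; ring. Qed.

Lemma lie_formZl (a : R) x z : lie_form (a *: x) z = a * lie_form x z.
Proof. by rewrite !lie_formE !mxE; ring. Qed.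

Lemma lie_formDr x y z : lie_form z (x + y) = lie_form z x + lie_form z y.
Proof. by rewrite lie_formC lie_formDl !(lie_formC z). Qed.

Lemma lie_formZr (a : R) x z : lie_form z (a *: x) = a * lie_form z x.
Proof. by rewrite lie_formC lie_formZl (lie_formC z). Qed.

Definition lie_formE' := (lie_formDl, lie_formDr, lie_formZl, lie_formZr).

Lemma lie_form_nondegenerate x : (forall y, lie_form x y = 0) -> x = 0.
Proof.
move=> x0; have {}x0 k : lie_form x (delta_mx 0 k) = 0 by [].
have xk (i j : 'I_5) : val i = val j -> x 0 i = x 0 j by move=> /val_inj ->.
apply/rowP; case=> [[|[|[|[|[|k]]]]] // ki]; rewrite mxE.
- by have := x0 0; rewrite lie_formE !mxE /= (xk (Ordinal ki) 0) //; lra.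
- by have := x0 1; rewrite lie_formE !mxE /= (xk (Ordinal ki) 1) //; lra.
- by have := x0 2; rewrite lie_formE !mxE /= (xk (Ordinal ki) 2) //; lra.
- by have := x0 3; rewrite lie_formE !mxE /= (xk (Ordinal ki) 3) //; lra.
- by have := x0 4; rewrite lie_formE !mxE /= (xk (Ordinal ki) 4) //; lra.
Qed.

Definition lie_isometry (f : 'End('rV[R]_5)) :=
  forall x y, lie_form (f x) (f y) = lie_form x y.

Lemma isometry_inj f : lie_isometry f -> lker f == 0%VS.
Proof.
move=> fE; rewrite -subv0; apply/subvP => x; rewrite memv_ker memv0 => /eqP fx.
apply/eqP/lie_form_nondegenerate => y.
by rewrite -fE fx -(scale0r 0) lie_formZl mul0r.
Qed.

Lemma isometry_comp f g :
  lie_isometry f -> lie_isometry g -> lie_isometry (g \o f)%VF.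
Proof. by move=> fE gE x y; rewrite !comp_lfunE gE fE. Qed.

Definition reflection n x := x - (2 * lie_form x n / lie_form n n) *: n.

Fact reflection_is_linear n : linear (reflection n).
Proof.
move=> a u v; rewrite /reflection !lie_formE'.
by apply/rowP => k; rewrite !mxE; ring.
Qed.

HB.instance Definition _ n := GRing.isLinear.Build R 'rV[R]_5 'rV[R]_5 _
  (reflection n) (reflection_is_linear n).

Lemma reflection_isometry n :
  lie_form n n != 0 -> lie_isometry (linfun (reflection n)).
Proof.
move=> n0 x y; rewrite !lfunE /= /reflection -!scaleNr !lie_formE'.
by rewrite (lie_formC n); field.
Qed.

(** Equal norms give [2 <p, p - q> = <p - q, p - q>], so the reflection along [p - q] moves [p] to
    [q]. *)
Lemma isometry_swap p q : lie_form p p = lie_form q q ->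
  lie_form (p - q) (p - q) != 0 -> exists2 f, lie_isometry f & f p = q.
Proof.
move=> pq d0; exists (linfun (reflection (p - q))).
  exact: reflection_isometry.
rewrite lfunE /= /reflection.
suff -> : 2 * lie_form p (p - q) / lie_form (p - q) (p - q) = 1.
  by rewrite scale1r opprB addrC subrK.
apply: (canLR (mulfK d0)).
rewrite -scaleN1r !lie_formE' (lie_formC q p) -pq; ring.
Qed.

(** The norms of [p - q] and [p + q] add up to [4 <p, p>], so one of them is nonzero. Reflecting
    along that vector sends [p] to [q] or to [- q]. *)
Lemma isometry_unit p q : lie_form p p = lie_form q q -> lie_form p p != 0 ->
  exists f (c : R), [/\ lie_isometry f, c != 0 & f p = c *: q].
Proof.
move=> pq p0.
have [d0|d0] := eqVneq (lie_form (p - q) (p - q)) 0; last first.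
  have [f fi fp] := isometry_swap pq d0.
  by exists f, 1; rewrite oner_neq0 scale1r.
have [||f fi fp] := @isometry_swap p (- q).
- by rewrite -scaleN1r !lie_formE' pq; ring.
- apply: contra p0 => /eqP; move: d0.
  rewrite opprK -scaleN1r !lie_formE' (lie_formC q p) -pq => d0 d1.
  by apply/eqP; lra.
by exists f, (-1); rewrite oppr_eq0 oner_neq0 scaleN1r.
Qed.

Lemma isometry_scale p q (c : R) : c != 0 ->
  lie_form p p = c ^+ 2 * lie_form q q -> lie_form p p != 0 ->
  exists f (c : R), [/\ lie_isometry f, c != 0 & f p = c *: q].
Proof.
move=> c0 pq p0; have [|f [e [fi e0 fp]]] := @isometry_unit p (c *: q) _ p0.
  by rewrite !lie_formE' pq; ring.
by exists f, (e * c); rewrite mulf_neq0 // -scalerA.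
Qed.

(** For null vectors, [p - q] has norm [- 2 <p, q>]. *)
Lemma isometry_null p q : lie_form p p = 0 -> lie_form q q = 0 ->
  lie_form p q != 0 -> exists2 f, lie_isometry f & f p = q.
Proof.
move=> pp qq pq; apply: isometry_swap; rewrite ?pp ?qq //.
rewrite -scaleN1r !lie_formE' (lie_formC q p) pp qq.
by apply: contra pq => /eqP e; apply/eqP; lra.
Qed.

(** An explicit case of Witt's theorem: the poles have norms 1, -1 and 0, so the sign of [<q, q>]
    selects the geometry. *)
Lemma laguerre_pole_isometry q : q != 0 ->
  exists g f (c : R),
    [/\ lie_isometry f, c != 0 & f (laguerre_pole R g) = c *: q].
Proof.
move=> q0.
have [qpos|qneg|qq] := ltrgt0P (lie_form q q).
- exists Hyperbolic.
  (* Multiplying [q] by this constant gives it the norm of the pole; the elliptic case uses the root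
     of [- <q, q>]. *)
  apply: (@isometry_scale _ _ (Num.sqrt (lie_form q q))^-1).
  + by rewrite invr_eq0 gt_eqF ?sqrtr_gt0.
  + rewrite exprVn sqr_sqrtr ?ltW // mulVf ?gt_eqF //.
    by rewrite lie_formE !mxE /=; ring.
  + by rewrite lie_formE !mxE /=; lra.
- exists Elliptic.
  apply: (@isometry_scale _ _ (Num.sqrt (- lie_form q q))^-1).
  + by rewrite invr_eq0 gt_eqF ?sqrtr_gt0; lra.
  + rewrite exprVn sqr_sqrtr; last lra.
    rewrite invrN mulNr mulVf ?lt_eqF //.
    by rewrite lie_formE !mxE /=; ring.
  + by rewrite lie_formE !mxE /=; lra.
exists Euclidean; pose p : 'rV[R]_5 := laguerre_pole R Euclidean.
have pp : lie_form p p = 0 by rewrite lie_formE !mxE /=; ring.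
suff [f fi fp] : exists2 f, lie_isometry f & f p = q.
  by exists f, 1; rewrite oner_neq0 scale1r.
have [pq|pq] := eqVneq (lie_form p q) 0; last exact: isometry_null.
(* Orthogonal null vectors are connected through a null [r] orthogonal to neither. *)
have chain r : lie_form r r = 0 -> lie_form p r != 0 -> lie_form r q != 0 ->
    exists2 f, lie_isometry f & f p = q.
  move=> rr pr rq; have [f fi fp] := isometry_null pp rr pr.
  have [g gi gr] := isometry_null rr qq rq.
  by exists (g \o f)%VF; [exact: isometry_comp|rewrite comp_lfunE fp].
have q23 : q 0 3 = q 0 2 by move: pq; rewrite lie_formE !mxE /=; lra.
(* The vector [e2 - e3] pairs with [q] to [2 q2]; when [q2 = 0], [e2 + e4] pairs to [- q4]. If both
   vanish, nullity forces [q = 0]. *)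
have [q2|q2] := eqVneq (q 0 2) 0; last first.
  apply: (chain (delta_mx 0 2 - delta_mx 0 3)); rewrite lie_formE !mxE /=.
  - by ring.
  - by lra.
  - by apply: contra q2 => /eqP e; apply/eqP; lra.
have [q4|q4] := eqVneq (q 0 4) 0; last first.
  apply: (chain (delta_mx 0 2 + delta_mx 0 4)); rewrite lie_formE !mxE /=.
  - by ring.
  - by lra.
  - by apply: contra q4 => /eqP e; apply/eqP; lra.
case/eqP: q0; move: qq; rewrite lie_formE q23 q2 q4 => qq.
have q1 : q 0 1 = 0 by nra.
have q0 : q 0 0 = 0 by nra.
have qk (i j : 'I_5) : val i = val j -> q 0 i = q 0 j by move=> /val_inj ->.
by apply/rowP; case=> [[|[|[|[|[|k]]]]] // ki]; rewrite mxE;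
  [rewrite (qk (Ordinal ki) 0)|rewrite (qk (Ordinal ki) 1)
  |rewrite (qk (Ordinal ki) 2)|rewrite (qk (Ordinal ki) 3)
  |rewrite (qk (Ordinal ki) 4)] => //; rewrite q23.
Qed.

(** * Orthogonal complements and isotropic subspaces *)

(** Pairing with a tuple as a linear map, so that the orthogonal complement is a kernel and
    rank-nullity applies. *)
Definition gram_row (k : nat) (b : k.-tuple 'rV[R]_5) x : 'rV[R]_k :=
  \row_j lie_form b`_j x.

Fact gram_row_is_linear k (b : k.-tuple 'rV[R]_5) : linear (gram_row b).
Proof. by move=> a u v; apply/rowP => j; rewrite !mxE !lie_formE'. Qed.

HB.instance Definition _ k (b : k.-tuple 'rV[R]_5) :=
  GRing.isLinear.Build R 'rV[R]_5 'rV[R]_k _ (gram_row b)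
    (gram_row_is_linear b).

Definition orthv k (b : k.-tuple 'rV[R]_5) := lker (linfun (gram_row b)).

Lemma orthvP k (b : k.-tuple 'rV[R]_5) x :
  reflect (forall j : 'I_k, lie_form b`_j x = 0) (x \in orthv b).
Proof.
rewrite memv_ker lfunE; apply: (iffP eqP) => [/rowP b0 j|b0].
  by have := b0 j; rewrite !mxE.
by apply/rowP => j; rewrite !mxE b0.
Qed.

(** Fewer than five linear equations on a 5-dimensional space have a nonzero common solution. *)
Lemma hyperplane_pole (U : {vspace 'rV[R]_5}) : (\dim U < 5)%N ->
  exists2 q, q != 0 & {in U, forall x, lie_form x q = 0}.
Proof.
move=> dU; pose f := linfun (gram_row (vbasis U)).
have q0 : vpick (lker f) != 0.
  rewrite vpick0 -dimv_eq0.
  have := limg_ker_dim f fullv; rewrite capfv dimvf /dim /= mul1n.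
  have := dimvS (subvf (f @: fullv)%VS); rewrite dimvf /dim /= mul1n.
  move: (\dim (lker f)) (\dim (f @: fullv)) => a b; lia.
exists (vpick (lker f)) => // x xU.
have /orthvP bq : vpick (lker f) \in orthv (vbasis U) by exact: memv_pick.
(* Orthogonality to the basis passes to [U] because the complement of [q] is a subspace. *)
have : (U <= orthv [tuple vpick (lker f)])%VS.
  rewrite -{1}(span_basis (vbasisP U)); apply/span_subvP => y.
  case/(nthP 0) => j; rewrite (size_tuple (vbasis U)) => jU <-.
  by apply/orthvP => k; rewrite ord1 /= lie_formC (bq (Ordinal jU)).
by move/subvP/(_ x xU)/orthvP/(_ ord0); rewrite lie_formC.
Qed.

(* The index of the form is 2: forgetting the first three coordinates is
   injective on an isotropic subspace. *)
Lemma isotropic_dim (U : {vspace 'rV[R]_5}) :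
  {in U, forall x, lie_form x x = 0} -> (\dim U <= 2)%N.
Proof.
move=> U0; pose b : 2.-tuple 'rV[R]_5 := [tuple delta_mx 0 3; delta_mx 0 4].
pose f := linfun (gram_row b).
have fU : (U :&: lker f)%VS = 0%VS.
  apply/eqP; rewrite -subv0; apply/subvP => x.
  rewrite memv_cap => /andP[/U0 xx /orthvP fx].
  have xk (i j : 'I_5) : val i = val j -> x 0 i = x 0 j by move=> /val_inj ->.
  have x3 : x 0 3 = 0 by have := fx 0; rewrite lie_formE !mxE /=; lra.
  have x4 : x 0 4 = 0 by have := fx 1; rewrite lie_formE !mxE /=; lra.
  move: xx; rewrite lie_formE x3 x4 => xx.
  (* What remains of the form is a sum of three squares. *)
  have [x0 x1 x2] : [/\ x 0 0 = 0, x 0 1 = 0 & x 0 2 = 0] by split; nra.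
  rewrite memv0; apply/eqP/rowP.
  by case=> [[|[|[|[|[|k]]]]] // ki]; rewrite mxE;
    [rewrite (xk (Ordinal ki) 0)|rewrite (xk (Ordinal ki) 1)
    |rewrite (xk (Ordinal ki) 2)|rewrite (xk (Ordinal ki) 3)
    |rewrite (xk (Ordinal ki) 4)].
rewrite -(limg_dim_eq fU) (leq_trans (dimvS (subvf _))) //.
by rewrite dimvf /dim /= mul1n.
Qed.

(** The symmetric matrix with zero diagonal and off-diagonal entries [ab], [ac], [bc] has
    determinant [2 ab ac bc]. The combination of the equations used below isolates [c]. *)
Lemma hollow_kernel (ab ac bc a b c : R) : ab != 0 -> ac != 0 -> bc != 0 ->
  b * ab + c * ac = 0 -> a * ab + c * bc = 0 -> a * ac + b * bc = 0 ->
  [/\ a = 0, b = 0 & c = 0].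
Proof.
move=> ab0 ac0 bc0 E1 E2 E3.
have c0 : c = 0.
  apply/eqP; have : 2 * (ac * bc) * c == 0.
    apply/eqP; transitivity ((a * ab + c * bc) * ac + (b * ab + c * ac) * bc
      - (a * ac + b * bc) * ab); first by ring.
    by rewrite E1 E2 E3 !mul0r subr0 addr0.
  by rewrite !mulf_eq0 pnatr_eq0 (negPf ac0) (negPf bc0).
move: E1 E2; rewrite c0 !mul0r !addr0 => /eqP + /eqP.
by rewrite !mulf_eq0 (negPf ab0) !orbF => /eqP -> /eqP ->.
Qed.

(* Otherwise the Gram matrix of [a], [b], [c] has zero diagonal and nonzero
   off-diagonal entries, so it is invertible and [v], [a], [b], [c] are
   independent. *)
Lemma cone_plane_collinear (v a b c : projpoint 'rV[R]_5) :
  {in [:: v; a; b; c], forall p : projpoint _, on_quadric (@lie_form R) p} ->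
  {in [:: a; b; c], forall p : projpoint _,
    {in line_of v & line_of p, forall x y, lie_form x y = 0}} ->
  coplanar [:: v; a; b; c] ->
  [\/ collinear v a b, collinear v a c | collinear v b c].
Proof.
move=> quad orth.
(* Here [v], [p], [r] are null and mutually orthogonal, so their span is isotropic and at most a
   projective line. *)
have iso (p r : projpoint 'rV[R]_5) :
    p \in [:: a; b; c] -> r \in [:: a; b; c] ->
    {in line_of p & line_of r, forall x y, lie_form x y = 0} -> collinear v p r.
  move=> pabc rabc pr; exists (v + (p + r))%VS; last first.
    by rewrite addvSl ?(subv_trans _ (addvSr v _)) ?addvSl ?addvSr.
  apply: isotropic_dim => _ /memv_addP[x xv [_ /memv_addP[y yp [z zr ->]] ->]].
  have xx := quad v (mem_head _ _) x xv.
  have yy : lie_form y y = 0 by apply: (quad p) => //; rewrite inE pabc orbT.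
  have zz : lie_form z z = 0 by apply: (quad r) => //; rewrite inE rabc orbT.
  rewrite !lie_formE' xx yy zz (lie_formC y x) (lie_formC z x) (lie_formC z y).
  by rewrite (orth p pabc) // (orth r rabc) // pr // !addr0.
have [[xv xv0 vE] [xa xa0 aE]] := (projpoint_vec v, projpoint_vec a).
have [[xb xb0 bE] [xc xc0 cE]] := (projpoint_vec b, projpoint_vec c).
have isol (p r : projpoint 'rV[R]_5) x y :
    p \in [:: a; b; c] -> r \in [:: a; b; c] ->
    line_of p = <[x]>%VS -> line_of r = <[y]>%VS -> lie_form x y = 0 ->
    collinear v p r.
  move=> pabc rabc pE rE xy; apply: iso => // ? ?.
  rewrite pE rE => /vlineP[s ->] /vlineP[t ->].
  by rewrite !lie_formE' xy !mulr0.
have [a3 b3 c3] := seq3_mem a b c.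
have [ab0|ab0] := eqVneq (lie_form xa xb) 0.
  by move=> _; apply: Or31; exact: isol a3 b3 aE bE ab0.
have [ac0|ac0] := eqVneq (lie_form xa xc) 0.
  by move=> _; apply: Or32; exact: isol a3 c3 aE cE ac0.
have [bc0|bc0] := eqVneq (lie_form xb xc) 0.
  by move=> _; apply: Or33; exact: isol b3 c3 bE cE bc0.
case=> E dE sE; exfalso.
have [v4 a4 b4 c4] := seq4_mem v a b c.
have xvv : xv \in line_of v by rewrite vE memv_line.
have xaa : xa \in line_of a by rewrite aE memv_line.
have xbb : xb \in line_of b by rewrite bE memv_line.
have xcc : xc \in line_of c by rewrite cE memv_line.
have va : lie_form xv xa = 0 by exact: (orth _ a3).
have vb : lie_form xv xb = 0 by exact: (orth _ b3).
have vc : lie_form xv xc = 0 by exact: (orth _ c3).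
have aa : lie_form xa xa = 0 by exact: (quad _ a4).
have bb : lie_form xb xb = 0 by exact: (quad _ b4).
have cc : lie_form xc xc = 0 by exact: (quad _ c4).
have fr : free [tuple xv; xa; xb; xc].
  apply/freeP => k; rewrite !big_ord_recl big_ord0 /=.
  set k0 := k _; set k1 := k _; set k2 := k _; set k3 := k _ => k0E.
  have pair y : k0 * lie_form xv y + k1 * lie_form xa y + k2 * lie_form xb y
      + k3 * lie_form xc y = 0.
    have <- : lie_form 0 y = 0 by rewrite -(scale0r 0) lie_formZl mul0r.
    by rewrite -k0E !lie_formE' -(scale0r 0) lie_formZl; ring.
  (* Pairing the relation with [xa], [xb], [xc] removes [k0], since [xv] is orthogonal to all
     three. *)
  have [||| k1z k2z k3z] := @hollow_kernel _ _ _ k1 k2 k3 ab0 ac0 bc0.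
  - have := pair xa; rewrite va aa (lie_formC xb) (lie_formC xc).
    by rewrite !mulr0 ?add0r ?addr0.
  - by have := pair xb; rewrite vb bb (lie_formC xc) !mulr0 ?add0r ?addr0.
  - by have := pair xc; rewrite vc cc !mulr0 ?add0r ?addr0.
  move: k0E; rewrite k1z k2z k3z !scale0r !addr0 => /eqP.
  rewrite scaler_eq0 (negPf xv0) orbF => /eqP k0z i.
  have kE (j : 'I_4) : val i = val j -> k i = k j by move=> /val_inj ->.
  case: i kE => [[|[|[|[|i]]]] // ki] kE;
    [rewrite -[RHS]k0z|rewrite -[RHS]k1z|rewrite -[RHS]k2z|rewrite -[RHS]k3z];
    exact: kE.
have : (<<[tuple xv; xa; xb; xc]>> <= E)%VS.
  apply/span_subvP => x; rewrite !inE => /or4P[]/eqP->.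
  - exact: (subvP (sE v v4)).
  - exact: (subvP (sE a a4)).
  - exact: (subvP (sE b b4)).
  - exact: (subvP (sE c c4)).
by move/dimvS; rewrite (eqP fr) dE.
Qed.

End LieForm.

(** * Generic nets: the common hyperplane and the excluded vertex *)

Section LieNet.
Variable R : realType.
Implicit Types l m : int -> projpoint 'rV[R]_5.

Lemma lie_net_swap l m : lie_checkerboard_net l m -> lie_checkerboard_net m l.
Proof.
case=> lq mq lm; split=> [//|//|i j ij].
have [sub _ _] := seq4_sub (m i) (m (i + 1)) (l j) (l (j + 1)).
by apply: (coplanar_sub sub); apply: lm; rewrite addrC.
Qed.

Lemma generic_net_swap l m : generic_net l m -> generic_net m l.
Proof.
move=> gen i j ij; have ji : (2 %| j + i)%Z by rewrite addrC.
exact: (general_octet_catC (s := [:: _; _; _; _]) (gen j i ji)).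
Qed.

(** On the diagonal the index sum [2k] is always even, so every [k] starts an octet. *)
Lemma generic_octet l m k : generic_net l m ->
  general_octet [:: l k; l (k + 1); l (k + 2); l (k + 3);
                    m k; m (k + 1); m (k + 2); m (k + 3)].
Proof. by move=> gen; apply: gen; lia. Qed.

Definition octet_span l m k :=
  (l k + l (k + 1)%R + (l (k + 2)%R + l (k + 3)%R) +
   (m k + m (k + 1)%R + (m (k + 2)%R + m (k + 3)%R)))%VS.

(** The planes needed have index pairs [(k, k)], [(k, k+2)], [(k+2, k)], [(k+2, k+2)] and
    [(k+1, k+1)], all of even sum. *)
Lemma dim_octet_span l m k : lie_checkerboard_net l m -> generic_net l m ->
  \dim (octet_span l m k) = 4%N.
Proof.
move=> [_ _ lm] gen; have V3 : (3 <= dim 'rV[R]_5)%N by rewrite /dim /= mul1n.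
have e2 : k + 1 + 1 = k + 2 by ring.
have e3 : k + 2 + 1 = k + 3 by ring.
apply: octet_dim V3 (generic_octet k gen) _ _ _ _ _; rewrite -?e3 -?e2;
  apply: lm; lia.
Qed.

(** Five of the six shared points already force the intersection of the two 4-dimensional spans to
    have dimension 4. *)
Lemma octet_spanS l m k : lie_checkerboard_net l m -> generic_net l m ->
  octet_span l m (k + 1) = octet_span l m k.
Proof.
move=> net gen; have V3 : (3 <= dim 'rV[R]_5)%N by rewrite /dim /= mul1n.
set U := octet_span l m k; set W := octet_span l m (k + 1).
have dU : \dim U = 4%N by exact: dim_octet_span.
have dW : \dim W = 4%N by exact: dim_octet_span.
have dUW : (3 < \dim (U :&: W))%N.
  pose b := [:: false; true; true; true; false; true; true].
  apply: (general_octet_mask (b := b) V3 (generic_octet k gen)) => //=.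
  have := subvv U; rewrite {1}/U /octet_span !subv_add.
  case/andP=> /andP[/andP[_ ?] /andP[? ?]] /andP[/andP[_ ?] /andP[? ?]].
  have := subvv W; rewrite {1}/W /octet_span !subv_add.
  have -> : k + 1 + 1 = k + 2 by ring.
  have -> : k + 1 + 2 = k + 3 by ring.
  case/andP=> /andP[/andP[? ?] /andP[? _]] /andP[/andP[? ?] /andP[? _]].
  by rewrite !subv_cap; do ! [apply/andP; split].
have UE : (U :&: W = U)%VS by apply/eqP; rewrite eqEdim capvSl dU.
by apply/eqP; rewrite eq_sym eqEdim dU dW -UE capvSr.
Qed.

Lemma net_hyperplane l m : lie_checkerboard_net l m -> generic_net l m ->
  exists2 U : {vspace 'rV[R]_5}, (\dim U < 5)%N &
    forall i, (l i <= U)%VS /\ (m i <= U)%VS.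
Proof.
move=> net gen; exists (octet_span l m 0); first by rewrite dim_octet_span.
move=> i; have <- : octet_span l m i = octet_span l m 0.
  elim/int_rect: i => [//|n IH|n IH].
    by rewrite -IH -(octet_spanS n%:Z net gen); congr octet_span; lia.
  rewrite -IH -[LHS](octet_spanS _ net gen).
  by congr octet_span; lia.
have := subvv (octet_span l m i); rewrite {1}/octet_span !subv_add.
by case/andP=> /andP[/andP[-> _] _] /andP[/andP[-> _] _].
Qed.

(** If [l i] were [q], it would be orthogonal to all circles, and both planes through it below would
    contain a collinear triple with [l i]. *)
Lemma net_avoids_pole l m (q : 'rV[R]_5) i : lie_checkerboard_net l m ->
  generic_net l m ->
  (forall j, {in line_of (l j), forall x, lie_form x q = 0}) ->
  (forall j, {in line_of (m j), forall x, lie_form x q = 0}) ->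
  line_of (l i) <> <[q]>%VS.
Proof.
move=> [lq mq lm] gen lo mo liE; have V3 : (3 <= dim 'rV[R]_5)%N.
  by rewrite /dim /= mul1n.
(* With this shift [l i] is the second circle of the octet, which then contains the quadruples at
   [(k, k)] and [(k+1, k+1)], both through [l i]. *)
pose k := i - 1; have i1 : i = k + 1 by rewrite /k; ring.
have e2 : k + 1 + 1 = k + 2 by ring.
rewrite {}i1 in liE.
have vo (p : projpoint 'rV[R]_5) : {in line_of p, forall x, lie_form x q = 0} ->
    {in line_of (l (k + 1)) & line_of p, forall x y, lie_form x y = 0}.
  move=> po x y; rewrite liE => /vlineP[c ->] /po yq.
  by rewrite lie_formZl lie_formC yq mulr0.
apply: (octet_not_two_collinear V3 (generic_octet k gen)).
- apply: cone_plane_collinear.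
  + by move=> p; rewrite !inE => /or4P[]/eqP->.
  + by move=> p; rewrite !inE => /or3P[]/eqP->; apply: vo.
  have [_ sub _] := seq4_sub (l k) (l (k + 1)) (m k) (m (k + 1)).
  by apply: (coplanar_sub sub); apply: lm; lia.
- apply: cone_plane_collinear.
  + by move=> p; rewrite !inE => /or4P[]/eqP->.
  + by move=> p; rewrite !inE => /or3P[]/eqP->; apply: vo.
  have [_ _ sub] := seq4_sub (l (k + 1)) (l (k + 2)) (m (k + 1)) (m (k + 2)).
  by apply: (coplanar_sub sub); rewrite -e2; apply: lm; lia.
Qed.

End LieNet.

(** * Transport of the net to a Laguerre geometry *)

Theorem theorem8p4 (R : realType) (l m : int -> projpoint 'rV[R]_5)
    (lm_net : lie_checkerboard_net l m) (lm_generic : generic_net l m) :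
  exists (g : plane_geometry) (l' m' : int -> projpoint 'rV[R]_4)
         (T : projpoint 'rV[R]_5 -> projpoint 'rV[R]_5),
    [/\ laguerre_checkerboard_net g l' m',
        lie_transformation T,
        forall i, l i = T (laguerre_embedding g (l' i)) &
        forall j, m j = T (laguerre_embedding g (m' j))].
Proof.
have [U dU lmU] := net_hyperplane lm_net lm_generic.
have [q q0 qU] := hyperplane_pole dU.
have lq i : {in line_of (l i), forall x, lie_form x q = 0}.
  by move=> x xl; apply: qU; apply: (subvP (lmU i).1).
have mq i : {in line_of (m i), forall x, lie_form x q = 0}.
  by move=> x xm; apply: qU; apply: (subvP (lmU i).2).
have [g [f [c [fi c0 fp]]]] := laguerre_pole_isometry q0.
have f_inj := isometry_inj fi.
pose F := (f \o linfun (lie_coords g))%VF.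
have FE z : F z = f (lie_coords g z) by rewrite comp_lfunE lfunE.
have F_inj : lker F == 0%VS.
  apply/lker0P => x y; rewrite !comp_lfunE => /(lker0P f_inj).
  exact: (lker0P (lker_lie_coords R g)).
(* Write [x = f y]. As [f] carries the pole to [c *: q], [y] is orthogonal to the pole and so has
   Laguerre coordinates. *)
have limF (p : projpoint 'rV[R]_5) :
    {in line_of p, forall x, lie_form x q = 0} -> (p <= limg F)%VS.
  move=> pq; apply/subvP => x /pq xq.
  have /memv_imgP[y _ xy] : x \in limg f by rewrite lker0_limgf ?memvf.
  have /lie_coords_pole[z yz] : lie_form y (laguerre_pole R g) = 0.
    by rewrite -fi -xy fp lie_formZr xq mulr0.
  by rewrite xy yz -FE memv_img ?memvf.
pose l' i := proj_preim F_inj (limF _ (lq i)).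
pose m' i := proj_preim F_inj (limF _ (mq i)).
have l'K i : proj_map F_inj (l' i) = l i by exact: proj_preimK.
have m'K i : proj_map F_inj (m' i) = m i by exact: proj_preimK.
have line (n : int -> projpoint 'rV[R]_5) (n' : int -> projpoint 'rV[R]_4) i :
    proj_map F_inj (n' i) = n i -> on_quadric (@lie_form R) (n i) ->
    line_of (n i) <> <[q]>%VS -> oriented_line g (n' i).
  move=> nE nq nv; split=> [z zn|gE n'v].
    rewrite -lie_form_lie_coords -fi -FE; apply: nq.
    by rewrite -nE memv_img.
  (* [F] sends the Euclidean vertex to [c *: q], so a line at the vertex would make the circle equal
     to [q]. *)
  case: nv; rewrite -nE /= n'v limg_line FE.
  have -> : lie_coords g (euclidean_vertex R) = laguerre_pole R g.
    rewrite gE; apply/rowP => k; rewrite !mxE.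
    by case: k => [[|[|[|[|[|k]]]]] // ki]; rewrite /= ?addr0 ?add0r.
  rewrite fp; apply/eqP; rewrite eqEdim !dim_vline q0 scaler_eq0.
  by rewrite (negPf c0) (negPf q0) andbT -memvE memvZ ?memv_line.
have [lQ mQ lm] := lm_net.
have lV i := net_avoids_pole (i := i) lm_net lm_generic lq mq.
have mV i := net_avoids_pole (i := i) (lie_net_swap lm_net)
  (generic_net_swap lm_generic) mq lq.
exists g, l', m', (proj_map f_inj); split.
- split=> [i|j|i j ij]; first exact: line (l'K i) (lQ i) (lV i).
    exact: line (m'K j) (mQ j) (mV j).
  apply: (coplanar_preim (f_inj := F_inj)); first by rewrite /dim /= mul1n.
  by rewrite /= !l'K !m'K; apply: lm.
- by exists f, f_inj.
- by move=> i; apply: val_inj; rewrite /= -limg_comp lpreimK ?limF.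
- by move=> j; apply: val_inj; rewrite /= -limg_comp lpreimK ?limF.
Qed.
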